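(* Let $\Omega\subset\mathbb{R}^N$ be a bounded domain, let $f$ satisfy (f1) and (f2) with $\sigma>0$, and let $u\in W^{1,\infty}_0(\Omega)$ be a solution of $\inf\{\mathcal{I}_\Omega(v): v\in W^{1,\infty}_0(\Omega)\}$. Then (i) $|\{x\in\Omega: |Du(x)|>\sigma\}|>0$; (ii) $u$ is the unique solution of this minimization problem.
   Context: $\mathcal{I}_\Omega(v)=\int_\Omega [f(|Dv|)-v]\,dx$. (f1) $f\in C^1([0,\infty))$ is convex, monotone nondecreasing, $f(0)=0$ and $\lim_{s\to\infty}f(s)/s=+\infty$; (f2) there exists $\sigma\ge0$ with $f'(s)=0$ for $0\le s\le\sigma$, $f'(s)>0$ for $s>\sigma$, $f\in C^{2,\alpha}(\sigma,\infty)$ for some $0<\alpha<1$, and $f''(s)>0$ for $s>\sigma$. *)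

(* Defs.v *)
From HB Require Import structures.
From mathcomp Require Import all_boot all_order all_algebra.
From mathcomp Require Import all_classical all_reals all_analysis.
Set Implicit Arguments. Unset Strict Implicit. Unset Printing Implicit Defensive.
Import Order.TTheory GRing.Theory Num.Theory.
Import numFieldNormedType.Exports.
Local Open Scope classical_set_scope.
Local Open Scope ring_scope.

Definition BorelRn (R : realType) (N : nat) :=
  g_sigma_algebraType (@open 'rV[R]_N).

(* mu is the N-dimensional Lebesgue measure (on Borel sets): it gives every
   closed box its volume.  This determines mu uniquely. *)
Definition is_lebesgue (R : realType) (N : nat)
    (mu : {measure set (BorelRn R N) -> \bar R}) : Prop :=
  forall a b : 'rV[R]_N, (forall i, a 0 i <= b 0 i) ->
    mu [set x : BorelRn R N | forall i, a 0 i <= x 0 i <= b 0 i]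
    = (\prod_(i < N) (b 0 i - a 0 i))%:E.

(* Euclidean norm of the gradient Du(x) at points where u is
   differentiable (everywhere but a null set for Lipschitz u,
   by Rademacher); set to 0 elsewhere. *)
Definition grad_norm (R : realType) (N : nat) (u : 'rV[R]_N -> R^o)
    (x : 'rV[R]_N) : R :=
  if `[< differentiable u x >] then
    Num.sqrt (\sum_(i < N) ('d u x (delta_mx 0 i : 'rV[R]_N)) ^+ 2)
  else 0.

Definition bounded_domain (R : realType) (N : nat) (Omega : set 'rV[R]_N) :=
  [/\ open Omega, connected Omega, Omega !=set0 &
      exists M : R, forall x, Omega x -> `|x| <= M].

(* W^{1,oo}_0(Omega), represented by zero extensions to R^N: the
   functions that are Lipschitz on R^N and vanish outside Omega. *)
Definition W1inf0 (R : realType) (N : nat) (Omega : set 'rV[R]_N)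
    (v : 'rV[R]_N -> R) : Prop :=
  (exists k : R, forall x y, `|v x - v y| <= k * `|x - y|) /\
  (forall x, ~ Omega x -> v x = 0).

Definition energy (R : realType) (N : nat)
    (mu : {measure set (BorelRn R N) -> \bar R}) (Omega : set 'rV[R]_N)
    (f : R -> R) (v : 'rV[R]_N -> R) : \bar R :=
  (\int[mu]_(x in (Omega : set (BorelRn R N))) (f (grad_norm v x) - v x)%:E)%E.

Definition is_minimizer (R : realType) (N : nat)
    (mu : {measure set (BorelRn R N) -> \bar R}) (Omega : set 'rV[R]_N)
    (f : R -> R) (u : 'rV[R]_N -> R) : Prop :=
  W1inf0 Omega u /\
  forall v, W1inf0 Omega v -> (energy mu Omega f u <= energy mu Omega f v)%E.

Definition cond_f1 (R : realType) (f f' : R -> R) : Prop :=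
  (forall s : R, 0 < s -> is_derive s 1 f (f' s)) /\
      (fun h => (f h - f 0) / h) @ 0^'+ --> f' 0 /\
      {within `[0, +oo[, continuous f'} /\
      (forall x y t : R, 0 <= x -> 0 <= y -> 0 <= t <= 1 ->
         f (t * x + (1 - t) * y) <= t * f x + (1 - t) * f y) /\
      (forall x y : R, 0 <= x -> x <= y -> f x <= f y) /\
      f 0 = 0 /\
      f s / s @[s --> +oo] --> +oo.

(* (f2), with f'' the derivative of f' on (sigma,oo); C^{2,alpha}(sigma,oo)
   is read as: f'' locally alpha-Hoelder on (sigma,oo). *)
Definition cond_f2 (R : realType) (f f' f'' : R -> R) (sigma alpha : R) : Prop :=
  0 <= sigma /\ 0 < alpha < 1 /\
      (forall s, 0 <= s <= sigma -> f' s = 0) /\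
      (forall s, sigma < s -> 0 < f' s) /\
      (forall s, sigma < s -> is_derive s 1 f' (f'' s)) /\
      (forall a b, sigma < a -> a <= b -> exists C : R,
         forall x y, a <= x <= b -> a <= y <= b ->
           `|f'' x - f'' y| <= C * `|x - y| `^ alpha) /\
      (forall s, sigma < s -> 0 < f'' s).

(* Main.v *)
(** If [u] minimizes the energy and [phi] is an admissible function with
    [D phi = 0] a.e. on [{|Du| > sigma}], then passing from [u] to [u + t phi]
    changes the gradient term only where [|Du| <= sigma], hence by at most
    [f (sigma + t L) = o(t)] per unit volume, while the linear term gains
    [t * \int phi]; so [\int phi <= 0].  If [{|Du| > sigma}] were null, a cone
    would be an admissible [phi], which is (i).  For (ii), two minimizers [u], [v]
    have [Du = Dv] a.e. on [{|Du| > sigma}], since [p |-> f |p|] is strictly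
    convex beyond [sigma]; so [phi = (u - v)^2] is admissible and [u = v].

    Rademacher's theorem is avoided: for two distinct values of [t], if
    [u + t phi] is differentiable at [x] for both then so is [u].  The sets of
    points where [u + t phi] is differentiable and [u] is not are thus disjoint
    for distinct [t], so they are null for all but countably many [t]. *)

Require Import Defs.
From HB Require Import structures.
From mathcomp Require Import all_boot all_order all_algebra.
From mathcomp Require Import finmap ring lra.
From mathcomp Require Import all_classical all_reals all_analysis measurable_realfun.
Import Order.TTheory GRing.Theory Num.Theory.
Import numFieldNormedType.Exports.
Local Open Scope classical_set_scope.
Local Open Scope ring_scope.

(** * Euclidean inner product and norm on row vectors *)

Section Euclidean.
Set Implicit Arguments.
Unset Strict Implicit.
Context {R : realType} {N : nat}.
Implicit Types (p q h : 'rV[R]_N) (a t : R).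

Definition dot p q : R := \sum_(i < N) p 0 i * q 0 i.
Definition enorm p : R := Num.sqrt (dot p p).
(** The norm carried by ['rV[R]_N] is the sup norm; this is its dual norm, hence the constant that
    bounds [dot p]. *)
Definition l1norm p : R := \sum_(i < N) `|p 0 i|.

Lemma dotC p q : dot p q = dot q p.
Proof. by apply: eq_bigr => i _; rewrite mulrC. Qed.

Lemma dotDl p q h : dot (p + q) h = dot p h + dot q h.
Proof. by rewrite -big_split; apply: eq_bigr => i _; rewrite mxE mulrDl. Qed.

Lemma dotZl a p h : dot (a *: p) h = a * dot p h.
Proof. by rewrite mulr_sumr; apply: eq_bigr => i _; rewrite mxE mulrA. Qed.

Lemma dotDr p q h : dot h (p + q) = dot h p + dot h q.
Proof. by rewrite dotC dotDl !(dotC h). Qed.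

Lemma dotZr a p h : dot h (a *: p) = a * dot h p.
Proof. by rewrite dotC dotZl (dotC h). Qed.

Lemma dotNl p h : dot (- p) h = - dot p h.
Proof. by rewrite -scaleN1r dotZl mulN1r. Qed.

Lemma dot_delta p (i : 'I_N) : dot p (delta_mx 0 i) = p 0 i.
Proof.
rewrite /dot (bigD1 i)//= mxE !eqxx mulr1 big1 ?addr0// => j ji.
by rewrite mxE (negPf ji) andbF mulr0.
Qed.

Lemma dot_ge0 p : 0 <= dot p p.
Proof. by apply: sumr_ge0 => i _; rewrite -expr2 sqr_ge0. Qed.

Lemma dot_eq0 p : dot p p = 0 -> p = 0.
Proof.
move=> p0; apply/rowP => i; rewrite mxE.
have /eqfun_inP/(_ i isT) : [forall (j | true), p 0 j * p 0 j == 0].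
  apply/forall_inP => j _.
  by have /eqP := p0; rewrite psumr_eq0 ?(fun k _ => _ : 0 <= p 0 k * p 0 k)//
    => [/allP/(_ j)|k _]; rewrite ?mem_index_enum -?expr2 ?sqr_ge0//; exact.
by move/eqP; rewrite mulf_eq0 orbb => /eqP.
Qed.

Lemma enorm_ge0 p : 0 <= enorm p.
Proof. exact: sqrtr_ge0. Qed.

Lemma sqr_enorm p : enorm p ^+ 2 = dot p p.
Proof. by rewrite sqr_sqrtr// dot_ge0. Qed.

Lemma enorm0 : enorm 0 = 0.
Proof. by rewrite /enorm -(scale0r 0) dotZl mul0r sqrtr0. Qed.

Lemma enormZ a p : enorm (a *: p) = `|a| * enorm p.
Proof. by rewrite /enorm dotZl dotZr mulrA -expr2 sqrtrM ?sqr_ge0// sqrtr_sqr. Qed.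

(** Expand the square of [enorm q *: p - enorm p *: q] and divide by the product of the norms; a
    zero norm is treated apart. *)
Lemma cauchy_schwarz p q : dot p q <= enorm p * enorm q.
Proof.
have [/eqP p0|p0] := boolP (enorm p == 0).
  have -> : p = 0 by apply: dot_eq0; rewrite -sqr_enorm p0 expr0n.
  by rewrite -(scale0r 0) dotZl mul0r mulr_ge0 ?enorm_ge0.
have [/eqP q0|q0] := boolP (enorm q == 0).
  have -> : q = 0 by apply: dot_eq0; rewrite -sqr_enorm q0 expr0n.
  by rewrite -(scale0r 0) dotZr mul0r mulr_ge0 ?enorm_ge0.
have := dot_ge0 (enorm q *: p + (- enorm p) *: q).
rewrite !(dotDl, dotDr, dotZl, dotZr) (dotC q p) -!sqr_enorm.
have pq : 0 < enorm p * enorm q by rewrite mulr_gt0// lt_def enorm_ge0 ?p0 ?q0.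
move: (enorm p) (enorm q) (dot p q) pq => x y d pq H.
rewrite -(ler_pM2l pq); nra.
Qed.

Lemma enormD p q : enorm (p + q) <= enorm p + enorm q.
Proof.
rewrite -ler_sqr ?nnegrE ?addr_ge0 ?enorm_ge0// sqr_enorm.
rewrite !(dotDl, dotDr) (dotC q p) -!sqr_enorm.
have := cauchy_schwarz p q; lra.
Qed.

(** After squaring, the convexity defect is [t (1 - t) |p - q|^2], which must vanish: spheres
    contain no segments. *)
Lemma enorm_convex_eq t p q : 0 < t < 1 -> enorm p = enorm q ->
  enorm ((1 - t) *: p + t *: q) = enorm p -> p = q.
Proof.
move=> /andP[t0 t1] pq.
move=> /(congr1 (fun x => x ^+ 2)); rewrite !sqr_enorm => H.
apply/eqP; rewrite -subr_eq0; apply/eqP; apply: dot_eq0.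
have := congr1 (fun x => x ^+ 2) pq; rewrite !sqr_enorm => pq2.
rewrite -[- q]scaleN1r.
move: H; rewrite !(dotDl, dotDr, dotZl, dotZr) (dotC q p) -!pq2 => H.
have t2 : t * (1 - t) != 0 by rewrite mulf_neq0; lra.
apply: (mulfI t2); move: (dot p p) (dot p q) H => a b H; lra.
Qed.

Lemma l1norm_ge0 p : 0 <= l1norm p.
Proof. by apply: sumr_ge0. Qed.

Lemma enorm_le_l1norm p : enorm p <= l1norm p.
Proof.
rewrite -ler_sqr ?nnegrE ?enorm_ge0 ?l1norm_ge0// sqr_enorm expr2 mulr_suml.
apply: ler_sum => i _; rewrite (le_trans (ler_norm _))// normrM ler_wpM2l//.
by rewrite /l1norm (bigD1 i)//= lerDl sumr_ge0.
Qed.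

Lemma coord_le_norm h (i : 'I_N) : `|h 0 i| <= `|h|.
Proof.
rewrite [leRHS]/Num.norm/= mx_normrE.
by apply: (le_bigmax _ (fun ij : 'I_1 * 'I_N => `|h ij.1 ij.2|) (0, i)).
Qed.

Lemma norm_dot_le p h : `|dot p h| <= l1norm p * `|h|.
Proof.
rewrite (le_trans (ler_norm_sum _ _ _))// mulr_suml ler_sum// => i _.
by rewrite normrM ler_wpM2l// coord_le_norm.
Qed.

Lemma l1norm_le p a : (forall i, `|p 0 i| <= a) -> l1norm p <= N%:R * a.
Proof.
move=> pa; rewrite (le_trans (ler_sum _ (fun i _ => pa i)))//.
by rewrite sumr_const card_ord mulr_natl.
Qed.

Lemma norm_delta (i : 'I_N) : `|delta_mx 0 i : 'rV[R]_N| = 1.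
Proof.
apply/eqP; rewrite eq_le; apply/andP; split.
  rewrite [leLHS]/Num.norm/= mx_normrE; apply/bigmax_leP; split => //= -[j k] _ /=.
  by rewrite mxE normr_nat; case: (_ && _).
by have := coord_le_norm (delta_mx 0 i) i; rewrite mxE !eqxx normr1.
Qed.

End Euclidean.

(** * Frechet gradients *)

Section Gradient.
Set Implicit Arguments.
Unset Strict Implicit.
Context {R : realType} {N : nat}.
Implicit Types (u v w : 'rV[R]_N -> R) (p q h x : 'rV[R]_N) (t : R).

(** Frechet differentiability with the gradient as an explicit vector, so that gradients can be
    combined and approximated in coordinates. *)
Definition has_grad u x p := forall eps : R, 0 < eps ->
  exists2 d : R, 0 < d &
    forall h, `|h| <= d -> `|u (x + h) - u x - dot p h| <= eps * `|h|.

Lemma has_gradP u x p :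
  has_grad u x p <->
  differentiable (u : 'rV[R]_N -> R^o) x /\
  forall h, 'd (u : 'rV[R]_N -> R^o) x h = dot p h.
Proof.
pose L : 'rV[R]_N -> R^o := dot p.
have Llin : linear L by move=> a y z; rewrite /L dotDr dotZr.
pose LL : {linear 'rV[R]_N -> R^o} :=
  HB.pack L (GRing.isLinear.Build _ _ _ _ L Llin).
have Lcont : continuous LL.
  apply: bounded_linear_continuous; exists (l1norm p); split; first exact: num_real.
  move=> M pM; near=> h; rewrite /= (le_trans (norm_dot_le _ _))//.
  rewrite (le_trans _ (ltW pM))// ler_piMr ?l1norm_ge0//.
split=> [up|[ud dE] eps e0].
  have K eps : 0 < eps ->
      \forall h \near (0 : 'rV[R]_N), `|u (h + x) - (u x + dot p h)| <= eps * `|h|.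
    move=> e0; have [d d0 ud] := up _ e0; apply/nbhs_normP; exists d => //= h.
    rewrite /ball_ /= sub0r normrN => /ltW /ud; rewrite opprD addrA (addrC x); exact.
  have dE : 'd (u : 'rV[R]_N -> R^o) x = L :> (_ -> _).
    by apply: (@diff_unique R 'rV[R]_N R^o u LL x Lcont); apply/eqaddoP => eps /K.
  split; last by move=> h; rewrite dE.
  apply/diff_locallyP; rewrite dE; split; first exact: Lcont.
  by apply/eqaddoP => eps /K.
have := diff_locally ud => /eqaddoP /(_ _ e0) /nbhs_normP[d /= d0 dP].
exists (d / 2); first by rewrite divr_gt0.
move=> h hd; have := dP h; rewrite /= sub0r normrN.
have hd' : `|h| < d by rewrite (le_lt_trans hd)// ltr_pdivrMr// mulr2n mulrDr mulr1 ltrDl.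
move=> /(_ hd'); rewrite !fctE/= dE opprD addrA (addrC h); exact.
Unshelve. all: by end_near. Qed.

Lemma has_grad_differentiable u x p :
  has_grad u x p -> differentiable (u : 'rV[R]_N -> R^o) x.
Proof. by case/has_gradP. Qed.

Lemma differentiable_has_grad u x :
  differentiable (u : 'rV[R]_N -> R^o) x -> exists p, has_grad u x p.
Proof.
move=> ud; exists (\row_i 'd (u : 'rV[R]_N -> R^o) x (delta_mx 0 i)).
apply/has_gradP; split=> // h; rewrite [in LHS](row_sum_delta h) linear_sum.
by apply: eq_bigr => i _; rewrite linearZ mxE mulrC.
Qed.

Lemma grad_normE u x p : has_grad u x p -> grad_norm u x = enorm p.
Proof.
move=> /has_gradP[ud dE]; rewrite /grad_norm asboolT//; congr Num.sqrt.
by apply: eq_bigr => i _; rewrite dE dot_delta expr2.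
Qed.

Lemma grad_norm0 u x : ~ differentiable (u : 'rV[R]_N -> R^o) x -> grad_norm u x = 0.
Proof. by move=> ud; rewrite /grad_norm asboolF. Qed.

Lemma grad_norm_ge0 u x : 0 <= grad_norm u x.
Proof. by rewrite /grad_norm; case: asbool => //; exact: sqrtr_ge0. Qed.

Lemma has_grad_lin u v x p q (a b : R) : has_grad u x p -> has_grad v x q ->
  has_grad (fun y => a * u y + b * v y) x (a *: p + b *: q).
Proof.
move=> up vq eps e0.
have ab : 0 < `|a| + `|b| + 1 by rewrite ltr_wpDl// addr_ge0.
have e1 : 0 < eps / (`|a| + `|b| + 1) by rewrite divr_gt0.
have [d d0 ud] := up _ e1; have [c c0 vc] := vq _ e1.
exists (Num.min d c); first by rewrite lt_min d0.
move=> h; rewrite le_min => /andP[/ud hu /vc hv].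
rewrite dotDl !dotZl.
have -> : a * u (x + h) + b * v (x + h) - (a * u x + b * v x) - (a * dot p h + b * dot q h)
  = a * (u (x + h) - u x - dot p h) + b * (v (x + h) - v x - dot q h) by ring.
rewrite (le_trans (ler_normD _ _))// !normrM.
rewrite (le_trans (lerD (ler_wpM2l (normr_ge0 a) hu) (ler_wpM2l (normr_ge0 b) hv)))//.
have -> : eps * `|h| = (`|a| + `|b| + 1) * (eps / (`|a| + `|b| + 1) * `|h|).
  by field; lra.
by rewrite -mulrDl ler_wpM2r// ?mulr_ge0// ?lerDl// ltW.
Qed.

(** [v] is a linear combination of [u + t v] and [u]. *)
Lemma has_grad_direction u v x p q t : t != 0 -> has_grad u x p ->
  has_grad (fun y => u y + t * v y) x q ->
  exists2 r, has_grad v x r & q = p + t *: r.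
Proof.
move=> t0 up uvq; exists (t^-1 *: q + - t^-1 *: p); last first.
  by rewrite scalerDr !scalerA mulrN mulfV// scale1r scaleN1r addrC subrK.
have := has_grad_lin t^-1 (- t^-1) uvq up; rewrite (_ : (fun y => _) = v)//.
by apply/funext => y; field.
Qed.

(** The increment of [w ^+ 2] factors as the increment of [w], which is [o(|h|)], times a sum
    bounded by [2 M]. *)
Lemma has_grad_sqr0 w x :
  has_grad w x 0 -> (exists M, forall y, `|w y| <= M) ->
  has_grad (fun y => w y ^+ 2) x 0.
Proof.
move=> w0 [M wM] eps e0.
have M0 : 0 <= M by rewrite (le_trans _ (wM x)).
have e1 : 0 < eps / (2 * M + 1) by rewrite divr_gt0// ltr_wpDl// mulr_ge0.
have [d d0 wd] := w0 _ e1; exists d => // h /wd.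
rewrite -(scale0r 0) !dotZl !mul0r !subr0 subr_sqr normrM => hw.
have s2 : `|w (x + h) + w x| <= 2 * M + 1.
  by rewrite (le_trans (ler_normD _ _))//; have := wM x; have := wM (x + h); lra.
rewrite (le_trans (ler_pM _ _ hw s2))//.
rewrite le_eqVlt; apply/orP; left; apply/eqP; field; lra.
Qed.

(** Difference quotients along the basis vectors are at most [|k|], hence so are the partial
    derivatives; the factor [N] comes from passing through [l1norm]. *)
Lemma lip_grad_norm_le u (k : R) :
  (forall x y, `|u x - u y| <= k * `|x - y|) -> forall x, grad_norm u x <= N%:R * `|k|.
Proof.
move=> uk x; have [ud|] := pselect (differentiable (u : 'rV[R]_N -> R^o) x); last first.
  by move=> /grad_norm0 ->; rewrite mulr_ge0.
have [p up] := differentiable_has_grad ud.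
rewrite (grad_normE up) (le_trans (enorm_le_l1norm _))//; apply: l1norm_le => i.
apply/ler_addgt0Pr => e e0; have [d d0 hd] := up _ e0.
have := hd (d *: delta_mx 0 i); rewrite dotZr dot_delta normrZ norm_delta mulr1 gtr0_norm//.
move=> /(_ (lexx _)) H; rewrite -(ler_pM2l d0).
have := uk (x + d *: delta_mx 0 i) x.
rewrite addrAC subrr add0r normrZ norm_delta mulr1 (gtr0_norm d0) => H2.
have -> : d * `|p 0 i| = `|d * p 0 i| by rewrite normrM gtr0_norm.
have -> : d * p 0 i = (u (x + d *: delta_mx 0 i) - u x) -
  (u (x + d *: delta_mx 0 i) - u x - d * p 0 i) by ring.
rewrite (le_trans (ler_normB _ _))// mulrDr lerD//; last by rewrite [leRHS]mulrC.
by rewrite (le_trans H2)// mulrC ler_wpM2l ?ler_norm// ltW.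
Qed.

End Gradient.

(** * Measurability of the differentiability set and of the gradient norm *)

Section GradientMeasurability.
Set Implicit Arguments.
Unset Strict Implicit.
Context {R : realType} {N : nat}.
Implicit Types (u v w : 'rV[R]_N -> R) (p q h x : 'rV[R]_N).

Lemma invS_le (d : R) : 0 < d -> exists k : nat, k.+1%:R^-1 <= d.
Proof.
move=> d0; exists (Num.truncn d^-1).
by rewrite invf_ple ?posrE//; apply/ltW/truncnS_gt.
Qed.

Lemma invS_gt0 (k : nat) : 0 < k.+1%:R^-1 :> R.
Proof. by rewrite invr_gt0. Qed.

Definition diffq u (k : nat) x : 'rV[R]_N :=
  \row_i (k.+1%:R * (u (x + k.+1%:R^-1 *: delta_mx 0 i) - u x)).

(* Testing differentiability against the difference quotients themselves,
   instead of an unknown gradient, makes each of these sets closed. *)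
Definition near_diff u (c : R) (n k : nat) : set 'rV[R]_N :=
  [set x | (forall h, `|h| <= k.+1%:R^-1 ->
      `|u (x + h) - u x - dot (diffq u k x) h| <= n.+1%:R^-1 * `|h|) /\
    enorm (diffq u k x) <= c + n.+1%:R^-1].

Lemma near_diff_exists u (c : R) x p : has_grad u x p -> enorm p <= c ->
  forall n, exists k, near_diff u c n k x.
Proof.
(* The tolerance is split into [N + 1] equal shares: one for the remainder of [p], one for each
   coordinate of [diffq u k x - p]. *)
move=> up pc n; pose e : R := n.+1%:R^-1 / N.+1%:R.
have e0 : 0 < e by rewrite divr_gt0// invS_gt0.
have [d d0 ud] := up _ e0; have [k kd] := invS_le d0; exists k.
have k0 := invS_gt0 k.
have qp i : `|(diffq u k x - p) 0 i| <= e.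
  have := ud (k.+1%:R^-1 *: delta_mx 0 i).
  rewrite normrZ norm_delta mulr1 (gtr0_norm k0) dotZr dot_delta => /(_ kd) H.
  rewrite !mxE -(ler_pM2l k0) -[X in X * _](gtr0_norm k0) -normrM mulrBr mulKf//.
  by rewrite [leRHS]mulrC.
have l1 := l1norm_le qp.
have eN : N%:R * e + e = n.+1%:R^-1.
  by rewrite -{2}[e]mul1r -mulrDl natr1 mulrC divfK.
split.
  move=> h hk; have := ud h (le_trans hk kd).
  have -> : u (x + h) - u x - dot (diffq u k x) h =
    (u (x + h) - u x - dot p h) - dot (diffq u k x - p) h.
    by rewrite dotDl dotNl; ring.
  move=> H; rewrite (le_trans (ler_normB _ _))//.
  rewrite -eN mulrDl addrC lerD//.
  by rewrite (le_trans (norm_dot_le _ _))// ler_wpM2r.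
rewrite -(subrK p (diffq u k x)) (le_trans (enormD _ _))// addrC lerD//.
by rewrite (le_trans (enorm_le_l1norm _))// (le_trans l1)// -eN lerDl ltW.
Qed.

(** Quotients at two tolerances differ by at most the sum of the tolerances, since both predict the
    same small increments of [u]; so they converge, and the limit inherits both estimates. *)
Lemma near_diff_has_grad u (c : R) x : (forall n, exists k, near_diff u c n k x) ->
  exists2 p, has_grad u x p & enorm p <= c.
Proof.
move=> /choice[k kP].
pose q n := diffq u (k n) x; pose e n : R := n.+1%:R^-1.
have e0 n : 0 < e n by exact: invS_gt0.
have qnm n m i : q n 0 i - e n <= q m 0 i + e m.
  (* An increment along basis vector [i] short enough for both scales. *)
  pose d : R := Num.min (k n).+1%:R^-1 (k m).+1%:R^-1.
  have d0 : 0 < d by rewrite lt_min !invS_gt0.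
  have dn : `|d *: delta_mx 0 i : 'rV[R]_N| = d by rewrite normrZ norm_delta mulr1 gtr0_norm.
  have Hn : d <= (k n).+1%:R^-1 by rewrite ge_min lexx.
  have Hm : d <= (k m).+1%:R^-1 by rewrite ge_min lexx orbT.
  have := (kP n).1 (d *: delta_mx 0 i); have := (kP m).1 (d *: delta_mx 0 i).
  rewrite dn !dotZr !dot_delta -/(q n) -/(q m) -/(e n) -/(e m).
  move=> /(_ Hm) /ler_normlP[A B] /(_ Hn) /ler_normlP[C D].
  by rewrite -(ler_pM2l d0); lra.
(* The gradient at [x] is the limit of the Cauchy sequence [q]. *)
pose p : 'rV[R]_N := \row_i sup [set q n 0 i - e n | n in [set: nat]].
(* The intervals of centre [q n 0 i] and radius [e n] pairwise meet, so the supremum of their left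
   ends lies in all of them. *)
have pq n i : `|(p - q n) 0 i| <= e n.
  rewrite !mxE; set S := [set _ | _ in _].
  have S0 : S !=set0 by exists (q 0%N 0 i - e 0%N); exists 0%N.
  have H1 : sup S <= q n 0 i + e n.
    by apply: ge_sup => // _ [m _ <-]; exact: qnm.
  have H2 : q n 0 i - e n <= sup S.
    apply: ub_le_sup; last by exists n.
    by exists (q 0%N 0 i + e 0%N) => _ [m _ <-]; exact: qnm.
  have -> : (k n).+1%:R * (u (x + (k n).+1%:R^-1 *: delta_mx 0 i) - u x) = q n 0 i.
    by rewrite mxE.
  by rewrite ler_norml; lra.
have l1 n := l1norm_le (pq n).
have small (eps : R) : 0 < eps -> exists n, N.+1%:R * e n <= eps.
  move=> eps0; have [n ne] := @invS_le (eps / N.+1%:R) (divr_gt0 eps0 (ltr0Sn _ _)).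
  by exists n; rewrite mulrC -ler_pdivlMr.
exists p.
  move=> eps eps0; have [n ne] := small _ eps0.
  exists (k n).+1%:R^-1; first exact: invS_gt0.
  move=> h /((kP n).1); rewrite -/(q n) -/(e n) => H.
  have -> : u (x + h) - u x - dot p h =
    (u (x + h) - u x - dot (q n) h) - dot (p - q n) h by rewrite dotDl dotNl; ring.
  rewrite (le_trans (ler_normB _ _))// (le_trans _ (ler_wpM2r (normr_ge0 h) ne))//.
  rewrite -natr1 addrC mulrDl mul1r mulrDl lerD//.
  by rewrite (le_trans (norm_dot_le _ _))// ler_wpM2r.
apply/ler_addgt0Pr => eps eps0; have [n ne] := small _ eps0.
rewrite -(subrK (q n) p) (le_trans (enormD _ _))//.
have H1 := le_trans (enorm_le_l1norm _) (l1 n).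
have := (kP n).2; rewrite -/(q n) -/(e n) => H2.
move: ne; rewrite -natr1 mulrDl mul1r; lra.
Qed.

Lemma continuous_subR (T : topologicalType) (f g : T -> R) :
  continuous f -> continuous g -> continuous (fun y : T => f y - g y).
Proof. by move=> fc gc y; apply: (@continuousB R R^o T f g y); [exact: fc|exact: gc]. Qed.

Lemma continuous_mulR (T : topologicalType) (f g : T -> R) :
  continuous f -> continuous g -> continuous (fun y : T => f y * g y).
Proof. by move=> fc gc y; apply: (@continuousM R T f g y); [exact: fc|exact: gc]. Qed.

Lemma continuous_sumR (T : topologicalType) (I : Type) (r : seq I) (F : I -> T -> R) :
  (forall i, continuous (F i)) -> continuous (fun y : T => \sum_(i <- r) F i y).
Proof.
move=> Fc; elim: r => [|i r IH].
  by under eq_fun do rewrite big_nil; move=> y; exact: cst_continuous.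
under eq_fun do rewrite big_cons.
by move=> y; apply: (@continuousD R R^o T (F i) (fun y : T => \sum_(j <- r) F j y) y);
  [exact: Fc|exact: IH].
Qed.

Lemma continuous_shift u a : continuous u -> continuous (fun x => u (x + a)).
Proof.
move=> uc x; apply: (@continuous_comp _ _ _ (fun x : 'rV[R]_N => x + a)); last exact: uc.
by apply: (@continuousD R 'rV[R]_N 'rV[R]_N id (cst a) x); [exact: cvg_id|exact: cst_continuous].
Qed.

Lemma continuous_diffq u (k : nat) (i : 'I_N) : continuous u ->
  continuous (fun x => diffq u k x 0 i).
Proof.
move=> uc; under eq_fun do rewrite mxE.
apply: (@continuous_mulR 'rV[R]_N (fun=> k.+1%:R)); first by move=> x; exact: cst_continuous.
by apply: (@continuous_subR 'rV[R]_N) => //; exact: continuous_shift.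
Qed.

Lemma closed_near_diff u (c : R) (n k : nat) : continuous u -> closed (near_diff u c n k).
Proof.
move=> uc.
have qc i := @continuous_diffq u k i uc.
have -> : near_diff u c n k =
  (\bigcap_(h in [set h | `|h| <= k.+1%:R^-1])
    [set x | `|u (x + h) - u x - dot (diffq u k x) h| <= n.+1%:R^-1 * `|h|]) `&`
  [set x | enorm (diffq u k x) <= c + n.+1%:R^-1].
  by apply/seteqP; split.
have lec (F : 'rV[R]_N -> R) (C : R) : continuous F -> closed [set x | F x <= C].
  move=> Fc; apply: (@preimage_closed _ _ F [set y : R | y <= C]); last exact: closed_le.
  by move=> x _; exact: Fc.
apply: closedI.
  apply: closed_bigI => h _; apply: lec => x.
  pose F x := u (x + h) - u x - dot (diffq u k x) h.
  suff Fc : continuous F by apply: (@continuous_comp _ _ _ F); [exact: Fc|exact: norm_continuous].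
  apply: (@continuous_subR 'rV[R]_N).
    by apply: (@continuous_subR 'rV[R]_N) => //; exact: continuous_shift.
  apply: (@continuous_sumR 'rV[R]_N) => i; apply: (@continuous_mulR 'rV[R]_N) => //.
  by move=> y; exact: cst_continuous.
apply: lec => x; pose F x := dot (diffq u k x) (diffq u k x).
suff Fc : continuous F by apply: (@continuous_comp _ _ _ F); [exact: Fc|exact: sqrt_continuous].
by apply: (@continuous_sumR 'rV[R]_N) => i; apply: (@continuous_mulR 'rV[R]_N).
Qed.

Lemma measurable_open_Rn (A : set 'rV[R]_N) : open A -> measurable (A : set (BorelRn R N)).
Proof. exact: sub_sigma_algebra. Qed.

Lemma measurable_closed_Rn (A : set 'rV[R]_N) : closed A -> measurable (A : set (BorelRn R N)).
Proof. by move=> /closed_openC/measurable_open_Rn/measurableC; rewrite setCK. Qed.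

(** Countably many tolerances and scales suffice, so the set is a countable intersection of
    countable unions of closed sets. *)
Lemma measurable_has_grad_le u (c : R) : continuous u ->
  measurable ([set x | exists2 p, has_grad u x p & enorm p <= c] : set (BorelRn R N)).
Proof.
move=> uc.
have -> : [set x | exists2 p, has_grad u x p & enorm p <= c] =
    \bigcap_n \bigcup_k near_diff u c n k.
  apply/seteqP; split=> x /=.
    by move=> [p up pc] n _; have [k ?] := near_diff_exists up pc n; exists k.
  by move=> H; apply: near_diff_has_grad => n; have [k] := H n I; exists k.
apply: bigcapT_measurable => n; apply: bigcupT_measurable => k.
by apply: measurable_closed_Rn; exact: closed_near_diff.
Qed.

Lemma measurable_differentiable u : continuous u ->
  measurable ([set x | differentiable (u : 'rV[R]_N -> R^o) x] : set (BorelRn R N)).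
Proof.
move=> uc.
have -> : [set x | differentiable (u : 'rV[R]_N -> R^o) x] =
    \bigcup_n [set x | exists2 p, has_grad u x p & enorm p <= n%:R].
  apply/seteqP; split=> x /=.
    move=> /differentiable_has_grad[p up]; exists (Num.truncn (enorm p)).+1 => //.
    by exists p => //; apply/ltW/truncnS_gt.
  by move=> [n _ [p /has_grad_differentiable]].
by apply: bigcupT_measurable => n; exact: measurable_has_grad_le.
Qed.

Lemma measurable_fun_gt d (T : measurableType d) (F : T -> R) :
  (forall c : R, measurable [set x | c < F x]) -> measurable_fun setT F.
Proof.
move=> mF; apply: (measurability (@RGenOInfty.G R)) => [|/= _ [_] [r] -> <-].
  exact: RGenOInfty.measurableE.
rewrite setTI; rewrite (_ : _ @^-1` _ = [set x | r < F x])//.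
by apply/seteqP; split=> x /=; rewrite in_itv/= andbT.
Qed.

Lemma continuous_measurable_Rn u : continuous u ->
  measurable_fun setT (u : BorelRn R N -> R).
Proof.
move=> uc; apply: measurable_fun_gt => c; apply: measurable_open_Rn.
apply: (@open_comp _ _ u [set y : R | c < y]); last exact: open_gt.
by move=> x _; exact: uc.
Qed.

Lemma measurable_grad_norm u : continuous u ->
  measurable_fun setT (grad_norm u : BorelRn R N -> R).
Proof.
move=> uc; apply: measurable_fun_gt => c.
have [c0|c0] := ltP c 0.
  rewrite (_ : [set _ | _] = setT); first exact: measurableT.
  by apply/seteqP; split=> // x _ /=; exact: lt_le_trans (grad_norm_ge0 _ _).
(* For [c >= 0] the default value 0 is not above [c], so only points of differentiability count. *)
rewrite (_ : [set _ | _] = [set x | differentiable (u : 'rV[R]_N -> R^o) x] `\`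
  [set x | exists2 p, has_grad u x p & enorm p <= c]).
  by apply: measurableD; [exact: measurable_differentiable|exact: measurable_has_grad_le].
apply/seteqP; split=> x /=.
  move=> cx; split.
    by apply: contrapT => /grad_norm0 H; move: cx; rewrite H ltNge c0.
  by move=> [p up]; rewrite leNgt -(grad_normE up) cx.
move=> [/differentiable_has_grad[p up] H].
by rewrite (grad_normE up) ltNge; apply/negP => pc; apply: H; exists p.
Qed.

End GradientMeasurability.

(** * The scalar integrand: flat up to [sigma], strictly increasing and strictly convex beyond *)

Section Integrand.
Set Implicit Arguments.
Unset Strict Implicit.
Context {R : realType} (f f' f'' : R -> R) (sigma alpha : R).
Context (Hf1 : cond_f1 f f') (Hf2 : cond_f2 f f' f'' sigma alpha)
  (Hsigma : 0 < sigma).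

Lemma integrand_mvt (a b : R) : 0 < a -> a < b ->
  exists2 c, a < c < b & f b - f a = f' c * (b - a).
Proof.
case: Hf1 => fd _ a0 ab.
have dab x : a <= x -> is_derive x 1 f (f' x).
  by move=> ax; apply: fd; exact: lt_le_trans ax.
have [||c cab E] := @MVT R f f' a b ab.
- by move=> x; rewrite in_itv/= => /andP[/ltW/dab].
- by apply: derivable_within_continuous => x; rewrite in_itv/= => /andP[/dab[]].
by exists c => //; move: cab; rewrite in_itv.
Qed.

Lemma integrand_deriv_lt (a b : R) : sigma < a -> a < b -> f' a < f' b.
Proof.
case: Hf2 => _ [_ [_ [_ [fd [_ f2]]]]] a0 ab; rewrite -subr_gt0.
have dab x : a <= x -> is_derive x 1 f' (f'' x).
  by move=> ax; apply: fd; exact: lt_le_trans ax.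
have [||c cab ->] := @MVT R f' f'' a b ab.
- by move=> x; rewrite in_itv/= => /andP[/ltW/dab].
- by apply: derivable_within_continuous => x; rewrite in_itv/= => /andP[/dab[]].
rewrite mulr_gt0 ?subr_gt0// f2// (lt_trans a0)//.
by move: cab; rewrite in_itv => /andP[].
Qed.

Lemma integrand_deriv0 (s : R) : 0 <= s <= sigma -> f' s = 0.
Proof. by case: Hf2 => _ [_ [H _]]; exact: H. Qed.

Lemma integrand_mono (x y : R) : 0 <= x -> x <= y -> f x <= f y.
Proof. by case: Hf1 => _ [_ [_ [_ [fm _]]]]; exact: fm. Qed.

Lemma integrand_convex (x y t : R) : 0 <= x -> 0 <= y -> 0 <= t <= 1 ->
  f ((1 - t) * x + t * y) <= (1 - t) * f x + t * f y.
Proof.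
case: Hf1 => _ [_ [_ [fc _]]] x0 y0 t01.
by have := fc y x t y0 x0 t01; rewrite ![t * _ + _]addrC.
Qed.

Lemma integrand0 : f 0 = 0.
Proof. by case: Hf1 => _ [_ [_ [_ [_ []]]]]. Qed.

Lemma integrand_ge0 (x : R) : 0 <= x -> 0 <= f x.
Proof. by move=> x0; rewrite -integrand0 integrand_mono. Qed.

(** By the mean value theorem [f] agrees at [sigma / 2] and [sigma], while convexity and [f 0 = 0]
    give [f (sigma / 2) <= f sigma / 2]; so [f sigma = 0], and monotonicity does the rest. *)
Lemma integrand_flat (s : R) : 0 <= s <= sigma -> f s = 0.
Proof.
move=> /andP[s0 ss].
suff fs0 : f sigma = 0.
  by apply/eqP; rewrite eq_le integrand_ge0// andbT -fs0 integrand_mono.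
have s0' := Hsigma.
have s2 : 0 < sigma / 2 by lra.
have s3 : sigma / 2 < sigma by lra.
have [c cs] := integrand_mvt s2 s3.
rewrite integrand_deriv0; last by lra.
rewrite mul0r => /eqP; rewrite subr_eq0 => /eqP E.
have := @integrand_convex 0 sigma (2^-1) (lexx 0) (ltW Hsigma).
have -> : (1 - 2^-1) * 0 + 2^-1 * sigma = sigma / 2 by lra.
rewrite integrand0 -E => H; have {}H : f sigma <= (1 - 2^-1) * 0 + 2^-1 * f sigma.
  by apply: H; lra.
have := integrand_ge0 (ltW Hsigma); lra.
Qed.

Lemma integrand_lt (x y : R) : sigma <= x -> x < y -> f x < f y.
Proof.
move=> sx xy; rewrite -subr_gt0.
have [c /andP[xc _] ->] := integrand_mvt (lt_le_trans Hsigma sx) xy.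
rewrite mulr_gt0 ?subr_gt0//.
by case: Hf2 => _ [_ [_ [H _]]]; apply: H; exact: le_lt_trans xc.
Qed.

Lemma integrand_gt0 (x : R) : sigma < x -> 0 < f x.
Proof.
by move=> sx; rewrite -(@integrand_flat sigma) ?lexx ?ltW// integrand_lt.
Qed.

(** Only [b] has to lie beyond [sigma]. If the intermediate point [m] is in the flat part, the left
    side is 0; otherwise the mean slope from [a] to [m] is below the one from [m] to [b]. *)
Lemma integrand_convex_lt (a b t : R) : 0 <= a -> a < b -> sigma < b -> 0 < t < 1 ->
  f ((1 - t) * a + t * b) < (1 - t) * f a + t * f b.
Proof.
move=> a0 ab sb t01; set m := _ + t * b.
have tab : 0 < t * (b - a) by rewrite mulr_gt0; lra.
have tab' : 0 < (1 - t) * (b - a) by rewrite mulr_gt0; lra.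
have am : a < m by rewrite /m; lra.
have mb : m < b by rewrite /m; lra.
have fa := integrand_ge0 a0.
have fb := integrand_gt0 sb.
have tfa : 0 <= (1 - t) * f a by rewrite mulr_ge0//; lra.
have tfb : 0 < t * f b by rewrite mulr_gt0//; lra.
have [ms|sm] := leP m sigma.
  by rewrite integrand_flat ?ms ?andbT; lra.
have [c2 /andP[mc2 c2b] E2] := integrand_mvt (lt_trans Hsigma sm) mb.
(* [c] will be the larger of [a] and [sigma]: the slope is taken where [f'] is strictly increasing,
   and [f a = f c] carries the bound over to [[a, m]]. *)
have key c : sigma <= c -> a <= c -> c < m -> (f a = f c) \/ a = c -> 
    f m < (1 - t) * f a + t * f b.
  move=> sc ac cm fac.
  have [c1 /andP[cc1 c1m] E1] := integrand_mvt (lt_le_trans Hsigma sc) cm.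
  have s1 : sigma < c1 by exact: le_lt_trans cc1.
  have f1 : 0 < f' c1 by case: Hf2 => _ [_ [_ [H _]]]; exact: H.
  have f12 : f' c1 < f' c2 by apply: integrand_deriv_lt => //; exact: lt_trans mc2.
  have {}E1 : f m - f a <= f' c1 * (m - a).
    have -> : f m - f a = f' c1 * (m - c) by case: fac => [->|->].
    by rewrite ler_pM2l//; lra.
  have E3 : f' c1 * (b - m) < f' c2 * (b - m) by rewrite ltr_pM2r//; lra.
  have E4 : (1 - t) * (f m - f a) <= (1 - t) * (f' c1 * (m - a)).
    by rewrite ler_pM2l//; lra.
  have E5 : t * (f' c1 * (b - m)) < t * (f b - f m) by rewrite ltr_pM2l ?E2//; lra.
  have E6 : (1 - t) * (f' c1 * (m - a)) = t * (f' c1 * (b - m)) by rewrite /m; ring.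
  lra.
have [sa|sa] := leP sigma a; first by apply: (key a) => //; right.
apply: (key sigma) => //; first exact: ltW.
by left; rewrite !integrand_flat ?lexx ?a0 ?ltW.
Qed.

Lemma integrand_convex_eq (a b t : R) : 0 <= a -> 0 <= b -> sigma < a -> 0 < t < 1 ->
  f ((1 - t) * a + t * b) = (1 - t) * f a + t * f b -> a = b.
Proof.
move=> a0 b0 sa t01 E; have [ab|ba|//] := ltgtP a b.
  by have := integrand_convex_lt a0 ab (lt_trans sa ab) t01; rewrite E ltxx.
have t01' : 0 < 1 - t < 1 by lra.
have := integrand_convex_lt b0 ba sa t01'.
have -> : 1 - (1 - t) = t by ring.
by rewrite addrC E addrC ltxx.
Qed.

(** Both [f] and [f'] vanish at [sigma], so this unfolds the derivative there; [sigma > 0] makes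
    that derivative two-sided. *)
Lemma integrand_little_o (eps : R) : 0 < eps ->
  exists2 d : R, 0 < d & forall h, 0 <= h <= d -> f (sigma + h) <= eps * h.
Proof.
move=> e0; have [dd dE] : is_derive sigma 1 f 0.
  have := Hf1.1 sigma Hsigma.
  by rewrite integrand_deriv0// lexx ltW.
have : h^-1 *: ((f \o shift sigma) (h *: (1 : R)) - f sigma) @[h --> 0^'] --> (0 : R^o).
  by rewrite -[X in _ --> X]dE; exact: dd.
move=> /(@cvgrPdist_le R R^o) /(_ _ e0) [d /= d0 dP].
exists (d / 2); first by lra.
move=> h /andP[h0 hd]; move: h0; rewrite le_eqVlt => /predU1P[<-|h0].
  by rewrite addr0 mulr0 integrand_flat ?lexx ?ltW.
have := dP h; rewrite /ball_/= sub0r normrN gtr0_norm// gt_eqF// => H.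
have {}H : `|0 - h^-1 *: (f (h *: 1 + sigma) - f sigma)| <= eps by apply: H => //; lra.
have E : 0 - h^-1 *: (f (h *: 1 + sigma) - f sigma) = - (h^-1 * f (sigma + h)) :> R.
  rewrite (@integrand_flat sigma) ?lexx ?ltW// -[h *: 1]/(h * 1) mulr1.
  by rewrite -[_ *: _]/(_ * (_ - _)) subr0 sub0r (addrC h).
move: H; rewrite E normrN normrM gtr0_norm ?invr_gt0// ler_pdivrMl// mulrC.
by apply: le_trans; exact: ler_norm.
Qed.

End Integrand.

(** Within finite measure only finitely many disjoint sets exceed a given size, so only countably
    many [B t] have positive measure; the interval []0, r[], of positive Lebesgue measure, is
    uncountable. *)
Lemma ex_null_disjoint d (T : measurableType d) (R : realType)
    (mu : {measure set T -> \bar R}) (D : set T) (B : R -> set T) (r : R) :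
  measurable D -> (mu D < +oo)%E -> (forall t, measurable (B t)) ->
  (forall t, B t `<=` D) -> (forall s t, s <> t -> B s `&` B t = set0) -> 0 < r ->
  exists2 t, 0 < t < r & mu (B t) = 0.
Proof.
move=> mD Dfin mB BD Bdisj r0; apply: contrapT => H.
have Bpos t : 0 < t < r -> exists n : nat, ((n.+1%:R^-1)%:E < mu (B t))%E.
  move=> tr; have : (0 < mu (B t))%E.
    by rewrite lt_neqAle measure_ge0 andbT; apply/eqP => E; apply: H; exists t.
  have Bfin : mu (B t) \is a fin_num.
    rewrite ge0_fin_numE//; apply: le_lt_trans Dfin; apply: le_measure; rewrite ?inE//.
  rewrite -(fineK Bfin) lte_fin => m0.
  exists (Num.truncn (fine (mu (B t)))^-1).
  by rewrite lte_fin invf_plt ?posrE// truncnS_gt.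
have /countable_lebesgue_measure0 : countable `]0, r[%classic.
  have -> : `]0, r[%classic = \bigcup_n [set t | 0 < t < r /\ ((n.+1%:R^-1)%:E < mu (B t))%E].
    apply/seteqP; split=> t /=; rewrite in_itv/=.
      by move=> tr; have [n ?] := Bpos _ tr; exists n.
    by move=> [n _ []].
  apply: bigcup_countable => // n _; apply: finite_set_countable.
  apply: contrapT => inf.
  (* [K] disjoint sets of measure above [n.+1%:R^-1] would together exceed [mu D]. *)
  pose K := (Num.truncn (fine (mu D) * n.+1%:R)).+1.
  have [F FA Fn] := infinite_set_fset K inf.
  have : (mu (\big[setU/set0]_(t <- F) B t) <= mu D)%E.
    apply: le_measure; rewrite ?inE//; first exact: bigsetU_measurable.
    by rewrite -bigcup_fset => x [t _ /BD].
  rewrite measure_fbigsetU//; last first.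
    apply/trivIsetP => s t _ _ /eqP st; exact: Bdisj.
  rewrite leNgt => /negP; apply.
  apply: (@lt_le_trans _ _ (\sum_(t <- F) (n.+1%:R^-1)%:E)); last first.
    rewrite !big_seq; apply: lee_sum => t tF; apply/ltW.
    by have [] := FA t tF.
  rewrite sumEFin big_const_seq count_predT iter_addr_0 -[mu D]fineK; last by rewrite ge0_fin_numE.
  rewrite lte_fin -[_ *+ #|` F|]mulr_natl ltr_pdivlMr//.
  by rewrite (lt_le_trans (truncnS_gt _))// ler_nat.
by rewrite lebesgue_measure_itv/= lte_fin r0 -EFinB subr0 => -[/eqP]; rewrite gt_eqF.
Qed.

(** * Convexity and perturbation of the radial integrand [p |-> f |p|] *)

Section RadialConvexity.
Set Implicit Arguments.
Unset Strict Implicit.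
Context {R : realType} {N : nat} (f f' f'' : R -> R) (sigma alpha : R).
Context (Hf1 : cond_f1 f f') (Hf2 : cond_f2 f f' f'' sigma alpha)
  (Hsigma : 0 < sigma).
Implicit Types (p q : 'rV[R]_N) (t : R).

Lemma enorm_convex p q t : 0 < t < 1 ->
  enorm ((1 - t) *: p + t *: q) <= (1 - t) * enorm p + t * enorm q.
Proof.
move=> t01; rewrite (le_trans (enormD _ _))// !enormZ !ger0_norm//; lra.
Qed.

Lemma radial_convex p q t : 0 < t < 1 ->
  f (enorm ((1 - t) *: p + t *: q)) <= (1 - t) * f (enorm p) + t * f (enorm q).
Proof.
move=> t01; apply: (le_trans (integrand_mono Hf1 (enorm_ge0 _) (enorm_convex p q t01))).
by apply: (integrand_convex Hf1); rewrite ?enorm_ge0//; lra.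
Qed.

(** Equality passes through [f ((1 - t) |p| + t |q|)]. Strict convexity of [f] gives [|p| = |q|],
    strict monotonicity beyond [sigma] gives the combination this same norm, and [enorm_convex_eq]
    concludes. *)
Lemma radial_convex_eq p q t : 0 < t < 1 -> sigma < enorm p ->
  f (enorm ((1 - t) *: p + t *: q)) = (1 - t) * f (enorm p) + t * f (enorm q) ->
  p = q.
Proof.
move=> t01 sp E.
have E2 : f ((1 - t) * enorm p + t * enorm q) = (1 - t) * f (enorm p) + t * f (enorm q).
  apply/eqP; rewrite eq_le; apply/andP; split.
    by apply: (integrand_convex Hf1); rewrite ?enorm_ge0//; lra.
  by rewrite -E (integrand_mono Hf1) ?enorm_ge0 ?enorm_convex.
have pq := integrand_convex_eq Hf1 Hf2 Hsigma (enorm_ge0 p) (enorm_ge0 q) sp t01 E2.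
apply: (enorm_convex_eq t01 pq); move: E; rewrite -pq -mulrDl subrK mul1r.
set r := enorm (_ + _) => E; have r0 : 0 <= r by exact: enorm_ge0.
have [rp|pr|//] := ltgtP r (enorm p); last first.
  by have := integrand_lt Hf1 Hf2 Hsigma (ltW sp) pr; rewrite E ltxx.
have [sr|rs] := leP sigma r.
  by have := integrand_lt Hf1 Hf2 Hsigma sr rp; rewrite E ltxx.
have := integrand_gt0 Hf1 Hf2 Hsigma sp.
by rewrite -E (integrand_flat Hf1 Hf2 Hsigma) ?ltxx// r0 ltW.
Qed.

(** Where [|p| > sigma] nothing changes since [q = 0]; elsewhere the new norm is at most
    [sigma + t L], and there [f] is at most [eps * (t * L)]. *)
Lemma radial_perturb p q t (L eps d : R) : 0 <= t -> enorm q <= L -> t * L <= d ->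
  0 <= eps -> (forall h, 0 <= h <= d -> f (sigma + h) <= eps * h) ->
  (sigma < enorm p -> enorm q = 0) ->
  f (enorm (p + t *: q)) <= f (enorm p) + eps * (t * L).
Proof.
move=> t0 qL tLd eps0 fd pq.
have L0 : 0 <= L by exact: le_trans (enorm_ge0 q) qL.
have tL0 : 0 <= t * L by exact: mulr_ge0.
have pqn : enorm (p + t *: q) <= enorm p + t * enorm q.
  by rewrite (le_trans (enormD _ _))// enormZ ger0_norm.
have [sp|ps] := ltP sigma (enorm p).
  rewrite (le_trans (integrand_mono Hf1 (enorm_ge0 _) pqn))//.
  by rewrite pq// mulr0 addr0 lerDl mulr_ge0.
rewrite -[leLHS]add0r lerD ?(integrand_ge0 Hf1 (enorm_ge0 _))//.
rewrite (le_trans _ (fd (t * L) _)) ?tL0//.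
apply: (integrand_mono Hf1 (enorm_ge0 _)); rewrite (le_trans pqn)// lerD//.
by rewrite ler_wpM2l.
Qed.

(** Where [u + t phi] is not differentiable, the default gradient 0 makes the left side [f 0 = 0].
    Elsewhere [u], hence [phi], has a gradient and the vector estimate applies. *)
Lemma integrand_variation (u phi : 'rV[R]_N -> R) (x : 'rV[R]_N) t (L eps d : R) :
  0 < t -> grad_norm phi x <= L -> t * L <= d ->
  0 <= eps -> (forall h, 0 <= h <= d -> f (sigma + h) <= eps * h) ->
  (differentiable ((fun y => u y + t * phi y) : 'rV[R]_N -> R^o) x ->
   differentiable (u : 'rV[R]_N -> R^o) x) ->
  (sigma < grad_norm u x -> has_grad phi x 0) ->
  f (grad_norm (fun y => u y + t * phi y) x) <= f (grad_norm u x) + eps * (t * L).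
Proof.
move=> t0 phiL tLd eps0 fd du gphi.
have [/[dup] dw /du|/grad_norm0 ->] :=
    pselect (differentiable ((fun y => u y + t * phi y) : 'rV[R]_N -> R^o) x); last first.
  rewrite (integrand0 Hf1) addr_ge0 ?(integrand_ge0 Hf1 (grad_norm_ge0 _ _))//.
  by rewrite !mulr_ge0 ?(ltW t0)// (le_trans (grad_norm_ge0 _ _) phiL).
move=> /differentiable_has_grad[p up]; have [q wq] := differentiable_has_grad dw.
have [r phir qE] := has_grad_direction (lt0r_neq0 t0) up wq.
rewrite (grad_normE wq) (grad_normE up) qE; apply: (radial_perturb (ltW t0) _ tLd eps0 fd).
  by rewrite -(grad_normE phir).
by rewrite -(grad_normE up) => /gphi/grad_normE; rewrite (grad_normE phir) enorm0.
Qed.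

(** Gradients of [u] and [v] are asked for only where [w] is differentiable: elsewhere the left side
    is [f 0 = 0]. *)
Lemma integrand_grad_convex (u v w : 'rV[R]_N -> R) (x : 'rV[R]_N) t : 0 < t < 1 ->
  (differentiable (w : 'rV[R]_N -> R^o) x -> exists p q,
    [/\ has_grad u x p, has_grad v x q & has_grad w x ((1 - t) *: p + t *: q)]) ->
  f (grad_norm w x) <= (1 - t) * f (grad_norm u x) + t * f (grad_norm v x).
Proof.
move=> t01; have [t0 t1] : 0 <= t /\ 0 <= 1 - t by lra.
move=> dw.
have [/dw[p [q [up vq wpq]]]|/grad_norm0 ->] :=
    pselect (differentiable (w : 'rV[R]_N -> R^o) x).
  by rewrite (grad_normE up) (grad_normE vq) (grad_normE wpq); exact: radial_convex.
rewrite (integrand0 Hf1) addr_ge0// mulr_ge0//.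
- exact: (integrand_ge0 Hf1 (grad_norm_ge0 u x)).
- exact: (integrand_ge0 Hf1 (grad_norm_ge0 v x)).
Qed.

(** The right side of the equality is positive, so [w] cannot have the default gradient 0 and is
    differentiable; the equality case for vectors then applies. *)
Lemma integrand_grad_convex_eq (u v w : 'rV[R]_N -> R) (x : 'rV[R]_N) t : 0 < t < 1 ->
  (differentiable (w : 'rV[R]_N -> R^o) x -> exists p q,
    [/\ has_grad u x p, has_grad v x q & has_grad w x ((1 - t) *: p + t *: q)]) ->
  sigma < grad_norm u x ->
  f (grad_norm w x) = (1 - t) * f (grad_norm u x) + t * f (grad_norm v x) ->
  has_grad (fun y => u y - v y) x 0.
Proof.
move=> t01; have [t0 t1] : 0 <= t /\ 0 < 1 - t by lra.
move=> dw su wE.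
have fu := integrand_gt0 Hf1 Hf2 Hsigma su.
have fv := integrand_ge0 Hf1 (grad_norm_ge0 v x).
have fw : 0 < f (grad_norm w x).
  by rewrite wE; exact: (ltr_pwDl (mulr_gt0 t1 fu) (mulr_ge0 t0 fv)).
have [p [q [up vq wpq]]] : exists p q,
    [/\ has_grad u x p, has_grad v x q & has_grad w x ((1 - t) *: p + t *: q)].
  apply: dw; apply: contrapT => /grad_norm0 E.
  by move: fw; rewrite E (integrand0 Hf1) ltxx.
have pq : p = q.
  apply: (radial_convex_eq t01); first by rewrite -(grad_normE up).
  by rewrite -(grad_normE up) -(grad_normE vq) -(grad_normE wpq).
have := has_grad_lin 1 (-1) up vq.
rewrite pq scale1r scaleN1r subrr (_ : (fun y => _) = (fun y => u y - v y))//.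
by apply/funext => y; rewrite mul1r mulN1r.
Qed.

Lemma measurable_integrand_grad (u : 'rV[R]_N -> R) : continuous u ->
  measurable_fun setT ((f \o grad_norm u) : BorelRn R N -> R).
Proof.
move=> uc.
(* [f] is monotone only on [[0, +oo)]; truncating its argument at 0 makes it monotone, hence
   measurable, on the whole line. *)
have mF : measurable_fun setT (fun s : R => f (Num.max s 0)).
  apply: nondecreasing_measurable => // x y xy; apply: (integrand_mono Hf1).
    by rewrite le_max lexx orbT.
  by rewrite ge_max !le_max xy lexx orbT.
rewrite (_ : _ \o _ = (fun s : R => f (Num.max s 0)) \o (grad_norm u : BorelRn R N -> R)).
  by apply: measurableT_comp => //; exact: measurable_grad_norm.
by apply/funext => x /=; rewrite max_l// grad_norm_ge0.
Qed.

End RadialConvexity.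

(** * Closure properties and examples of admissible functions *)

Section AdmissibleFunctions.
Set Implicit Arguments.
Unset Strict Implicit.
Context {R : realType} {N : nat} (Omega : set 'rV[R]_N).
Implicit Types (u v w : 'rV[R]_N -> R) (x : 'rV[R]_N).

Lemma W1inf0_continuous u : W1inf0 Omega u -> continuous u.
Proof.
move=> [[k uk] _] x; apply/(@cvgrPdist_le R R^o _ _ (nbhs_filter (x : 'rV[R]_N))) => e e0.
have k0 : 0 < `|k| + 1 by rewrite ltr_wpDl.
apply/(@nbhs_normP R 'rV[R]_N); exists (e / (`|k| + 1)) => /=; first by rewrite divr_gt0.
move=> y; rewrite /ball_/= => xy; rewrite (le_trans (uk _ _))//.
rewrite (le_trans (ler_wpM2r (normr_ge0 _) (ler_norm k)))//.
move: xy => /ltW; rewrite ler_pdivlMr// => xy; rewrite (le_trans _ xy)//.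
by rewrite mulrC ler_wpM2l// lerDl.
Qed.

Lemma W1inf0_lin u v (a : R) : W1inf0 Omega u -> W1inf0 Omega v ->
  W1inf0 Omega (fun x => u x + a * v x).
Proof.
move=> [[k uk] u0] [[l vl] v0]; split; last first.
  by move=> x Ox; rewrite u0// v0// mulr0 addr0.
exists (k + `|a| * l) => x y.
have -> : u x + a * v x - (u y + a * v y) = (u x - u y) + a * (v x - v y) by ring.
rewrite (le_trans (ler_normD _ _))// normrM mulrDl lerD// -mulrA.
by rewrite ler_wpM2l.
Qed.

Lemma W1inf0_bounded u : (0 < N)%N -> (exists M : R, forall x, Omega x -> `|x| <= M) ->
  W1inf0 Omega u -> exists M : R, forall x, `|u x| <= M.
Proof.
move=> N0 [M OM] [[k uk] u0].
(* A reference point outside [Omega], where [u] vanishes; [0 < N] provides a coordinate that makes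
   its norm exceed [M]. *)
pose c : 'rV[R]_N := const_mx (`|M| + 1).
have cM : `|M| + 1 <= `|c|.
  have := coord_le_norm c (Ordinal N0); rewrite mxE ger0_norm//.
have cO : ~ Omega c.
  by move=> /OM; have := ler_norm M; move: cM; lra.
exists (`|k| * (`|M| + `|c|)) => x; have [Ox|nOx] := pselect (Omega x); last first.
  by rewrite u0// normr0 mulr_ge0// addr_ge0.
have := uk x c; rewrite (u0 c)// subr0 => /le_trans; apply.
rewrite (le_trans (ler_wpM2r (normr_ge0 _) (ler_norm k)))// ler_wpM2l//.
by rewrite (le_trans (ler_normB _ _))// lerD2r (le_trans (OM _ Ox))// ler_norm.
Qed.

Lemma W1inf0_sqr u : (exists M : R, forall x, `|u x| <= M) ->
  W1inf0 Omega u -> W1inf0 Omega (fun x => u x ^+ 2).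
Proof.
move=> [M uM] [[k uk] u0]; split; last by move=> x Ox; rewrite u0// expr0n.
exists (k * (M + M)) => x y; rewrite subr_sqr normrM mulrAC ler_pM//.
by rewrite (le_trans (ler_normD _ _))// lerD.
Qed.

(** The cone is taken in the sup norm, whose balls come from the openness of [Omega]; the reverse
    triangle inequality makes it 1-Lipschitz. *)
Lemma W1inf0_cone x0 (r : R) : (forall x, `|x0 - x| < r -> Omega x) ->
  W1inf0 Omega (fun x => Num.max 0 (r - `|x0 - x|)).
Proof.
move=> rO; split; last first.
  by move=> x Ox; apply: max_l; rewrite subr_le0 leNgt; apply/negP => /rO.
exists 1 => x y; rewrite mul1r.
have xy : `| `|x0 - y| - `|x0 - x| | <= `|x - y|.
  rewrite (le_trans (ler_dist_dist _ _))//.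
  by have -> : x0 - y - (x0 - x) = x - y by rewrite opprB addrC addrA subrK.
move: xy => /ler_normlP[A B]; apply/ler_normlP; rewrite opprB.
split; rewrite lerBlDr ge_max addr_ge0 ?le_max ?lexx//= ?orbT//.
- by rewrite addr_maxr ?le_max; apply/orP; right; lra.
- by rewrite addr_maxr ?le_max; apply/orP; right; lra.
Qed.

End AdmissibleFunctions.

(** * Lebesgue measure of bounded and of open sets; integrals of continuous functions *)

Section LebesgueMeasure.
Set Implicit Arguments.
Unset Strict Implicit.
Context {R : realType} {N : nat} (mu : {measure set (BorelRn R N) -> \bar R}).
Context (Hmu : is_lebesgue mu).

Lemma closed_box (a b : 'rV[R]_N) :
  closed [set x : 'rV[R]_N | forall i, a 0 i <= x 0 i <= b 0 i].
Proof.
rewrite (_ : [set _ | _] = \bigcap_i ((fun x : 'rV[R]_N => x 0 i) @^-1` `[a 0 i, b 0 i])).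
  apply: closed_bigI => i _; apply: preimage_closed; last exact: itv_closed.
  by move=> x _; exact: coord_continuous.
apply/seteqP; split=> x /=.
  by move=> H i _ /=; rewrite in_itv/=.
by move=> H i; have := H i I; rewrite /= in_itv.
Qed.

Lemma norm_le_coord (h : 'rV[R]_N) (e : R) : 0 <= e -> (forall i, `|h 0 i| <= e) -> `|h| <= e.
Proof.
move=> e0 he; rewrite [leLHS]/Num.norm/= mx_normrE; apply/bigmax_leP; split => //= -[j i] _ /=.
by rewrite (ord1 j).
Qed.

Lemma lebesgue_bounded_fin (A : set 'rV[R]_N) : measurable (A : set (BorelRn R N)) ->
  (exists M : R, forall x, A x -> `|x| <= M) -> (mu A < +oo)%E.
Proof.
move=> mA [M AM]; pose c : 'rV[R]_N := const_mx `|M|.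
pose B : set (BorelRn R N) := [set x | forall i, (- c) 0 i <= x 0 i <= c 0 i].
have muB : mu B = (\prod_(i < N) (c 0 i - (- c) 0 i))%:E.
  by apply: Hmu => i; rewrite !mxE; have := normr_ge0 M; lra.
apply: (@le_lt_trans _ _ (mu B)); last by rewrite muB ltry.
apply: le_measure; rewrite ?inE//; first by apply: measurable_closed_Rn; exact: closed_box.
move=> x /AM xM i; rewrite !mxE -ler_norml (le_trans (coord_le_norm _ _))//.
by rewrite (le_trans xM)// ler_norm.
Qed.

Lemma lebesgue_open_gt0 (U : set 'rV[R]_N) : open U -> U !=set0 -> (0 < mu U)%E.
Proof.
move=> oU [x Ux]; have := open_nbhs_nbhs (conj oU Ux).
move=> /nbhs_normP[e /= e0 eU]; pose c : 'rV[R]_N := const_mx (e / 2).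
have e2 : 0 < e / 2 by rewrite divr_gt0.
pose B : set (BorelRn R N) := [set y | forall i, (x - c) 0 i <= y 0 i <= (x + c) 0 i].
apply: (@lt_le_trans _ _ (mu B)).
  rewrite Hmu; last by move=> i; rewrite !mxE; lra.
  by rewrite lte_fin; apply: prodr_gt0 => i _; rewrite !mxE; lra.
apply: le_measure; rewrite ?inE//.
- by apply: measurable_closed_Rn; exact: closed_box.
- exact: measurable_open_Rn.
- move=> y /= H; apply: eU; rewrite /ball_/=; apply: (@le_lt_trans _ _ (e / 2)); last lra.
  apply: norm_le_coord; first exact: ltW.
  by move=> i; have := H i; rewrite !mxE ler_norml; lra.
Qed.

(** Were [g x > 0], then [g > g x / 2] on a nonempty open subset of [U], which has positive measure;
    Markov's inequality would make the integral positive. *)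
Lemma integral_le0_continuous (U : set 'rV[R]_N) (g : 'rV[R]_N -> R) : open U ->
  continuous g -> (forall x, 0 <= g x) ->
  (\int[mu]_(x in (U : set (BorelRn R N))) (g x)%:E <= 0)%E ->
  forall x, U x -> g x = 0.
Proof.
move=> oU gc g0 Ig x Ux; apply/eqP; rewrite eq_le g0 andbT leNgt; apply/negP => gx.
pose V : set 'rV[R]_N := U `&` (g @^-1` [set y : R | g x / 2 < y]).
have oV : open V.
  by apply: openI => //; apply: open_comp; [move=> y _; exact: gc|exact: open_gt].
have V0 : V !=set0 by exists x; split => //=; lra.
have mV := lebesgue_open_gt0 oV V0.
have mg : measurable_fun (U : set (BorelRn R N)) (fun y : BorelRn R N => (g y)%:E).
  by apply/measurable_EFinP; apply: measurable_funTS; exact: continuous_measurable_Rn.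
have gx2 : 0 < g x / 2 by lra.
have := le_integral_abse mu (measurable_open_Rn oU) mg gx2.
under eq_integral do rewrite /= ger0_norm//.
move=> /le_trans/(_ Ig); apply/negP; rewrite -ltNge mule_gt0//.
apply: (lt_le_trans mV); apply: le_measure; rewrite ?inE//.
- exact: measurable_open_Rn.
- apply: emeasurable_fun_c_infty => //; first exact: measurable_open_Rn.
  exact: measurableT_comp.
- move=> y [Uy /= gy]; split => //=; rewrite lee_fin ger0_norm//; exact: ltW.
Qed.

End LebesgueMeasure.

(** * Real-valued integrals up to a null set *)

Section RintegralOffNull.
Set Implicit Arguments.
Unset Strict Implicit.
Context d (T : measurableType d) {R : realType} (mu : {measure set T -> \bar R}).
Context (D Z : set T).
Context (mD : measurable D) (mZ : measurable Z) (muZ : mu Z = 0).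

Lemma le_Rintegral_off_null (g h : T -> R) :
  mu.-integrable D (EFin \o g) -> mu.-integrable D (EFin \o h) ->
  (forall x, D x -> ~ Z x -> g x <= h x) ->
  \int[mu]_(x in D) g x <= \int[mu]_(x in D) h x.
Proof.
move=> ig ih gh; rewrite /Rintegral.
rewrite (negligible_integral mZ mD ig muZ) (negligible_integral mZ mD ih muZ).
have mDZ : measurable (D `\` Z) by exact: measurableD.
apply: le_Rintegral => //; last by move=> x [Dx Zx]; exact: gh.
- by apply: (integrableS mD mDZ _ ig) => x [].
- by apply: (integrableS mD mDZ _ ih) => x [].
Qed.

Lemma le_Rintegral_off_null_addr (g h : T -> R) (c : R) : (mu D < +oo)%E ->
  mu.-integrable D (EFin \o g) -> mu.-integrable D (EFin \o h) ->
  (forall x, D x -> ~ Z x -> g x <= h x + c) ->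
  \int[mu]_(x in D) g x <= \int[mu]_(x in D) h x + c * fine (mu D).
Proof.
move=> Dfin ig ih gh.
have ic : mu.-integrable D (EFin \o (fun=> c)).
  apply: measurable_bounded_integrable => //.
  by exists `|c|; split=> [|M cM y _ /=]; [exact: num_real|exact: ltW].
rewrite -Rintegral_cst// -RintegralD//.
by apply: le_Rintegral_off_null => //; exact: (integrableD mD ih ic).
Qed.

(** Off [Z] the function equals its absolute value, whose integral must therefore vanish; [Y]
    contains [Z], where the sign of [g] is unknown. *)
Lemma Rintegral_le0_off_null (g : T -> R) :
  mu.-integrable D (EFin \o g) -> (forall x, D x -> ~ Z x -> 0 <= g x) ->
  \int[mu]_(x in D) g x <= 0 ->
  exists Y : set T, [/\ measurable Y, mu Y = 0 & forall x, D x -> ~ Y x -> g x = 0].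
Proof.
move=> ig g0 Ig; have mDZ : measurable (D `\` Z) by exact: measurableD.
have ig' : mu.-integrable (D `\` Z) (EFin \o g).
  by apply: (integrableS mD mDZ _ ig) => x [].
have mg : measurable_fun (D `\` Z) (EFin \o g) by exact: measurable_int ig'.
have : (\int[mu]_(x in D `\` Z) `|(EFin \o g) x| = 0)%E.
  apply/eqP; rewrite eq_le integral_ge0// andbT.
  rewrite (_ : (\int[mu]_(x in _) _)%E = (\int[mu]_(x in D `\` Z) (g x)%:E)%E).
    rewrite -(negligible_integral mZ mD ig muZ) -[leLHS]fineK ?lee_fin//.
    exact: integrable_fin_num.
  by apply: eq_integral => x /set_mem[Dx Zx]; rewrite /= ger0_norm// g0.
move=> /(ae_eq_integral_abs mu mDZ mg)[A [mA muA sA]].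
exists (Z `|` A); split; first exact: measurableU.
  by rewrite measureU0.
move=> x Dx ZA; apply: contrapT => gx; apply: ZA.
have [Zx|Zx] := pselect (Z x); [by left|right].
by apply: sA => /= H; apply: gx; have [] := H (conj Dx Zx).
Qed.

Lemma integrable_comb3 (g1 g2 g3 : T -> R) (a b : R) :
  mu.-integrable D (EFin \o g1) -> mu.-integrable D (EFin \o g2) ->
  mu.-integrable D (EFin \o g3) ->
  mu.-integrable D (EFin \o (fun x => a * g1 x + b * g2 x - g3 x)).
Proof.
move=> i1 i2 i3; have i1' := integrableZl mD a i1; have i2' := integrableZl mD b i2.
exact: (integrableB mD (integrableD mD i1' i2') i3).
Qed.

Lemma Rintegral_comb3 (g1 g2 g3 : T -> R) (a b : R) :
  mu.-integrable D (EFin \o g1) -> mu.-integrable D (EFin \o g2) ->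
  mu.-integrable D (EFin \o g3) ->
  \int[mu]_(x in D) (a * g1 x + b * g2 x - g3 x) =
  a * \int[mu]_(x in D) g1 x + b * \int[mu]_(x in D) g2 x - \int[mu]_(x in D) g3 x.
Proof.
move=> i1 i2 i3; have i1' := integrableZl mD a i1; have i2' := integrableZl mD b i2.
rewrite RintegralB//; last exact: (integrableD mD i1' i2').
by rewrite RintegralD// !RintegralZl.
Qed.

End RintegralOffNull.

(** [u] is the combination of the two functions with coefficients [t / (t - s)] and
    [- s / (t - s)]. *)
Lemma affine_line_differentiable {R : realType} {N : nat} (u w : 'rV[R]_N -> R)
    (s t : R) (x : 'rV[R]_N) : s <> t ->
  differentiable ((fun y => u y + s * w y) : 'rV[R]_N -> R^o) x ->
  differentiable ((fun y => u y + t * w y) : 'rV[R]_N -> R^o) x ->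
  differentiable (u : 'rV[R]_N -> R^o) x.
Proof.
move=> /eqP st /differentiable_has_grad[p sp] /differentiable_has_grad[q tq].
have st0 : t - s != 0 by rewrite subr_eq0 eq_sym.
have := has_grad_lin (t / (t - s)) (- s / (t - s)) sp tq.
rewrite (_ : (fun y => _) = u); first exact: has_grad_differentiable.
by apply/funext => y; field.
Qed.

(** Serves to recover [v] from [u] and [w = u + t (v - u)]. *)
Lemma line_endpoint (F : fieldType) (t a b : F) : t != 0 ->
  t^-1 * (a + t * (b + (-1) * a)) + (1 - t^-1) * a = b.
Proof. by move=> t0; field. Qed.

(** [A] and [B] stand for the gradient integrals of [u] and [u + t phi], [U] and [P] for the
    integrals of [u] and [phi], [m] for the measure of the domain. *)
Lemma variation_energy_le (F : realFieldType) (A B U P e t L m : F) : 0 < t ->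
  B <= A + e * (t * L) * m -> A - U <= B - (U + t * P) -> P <= e * (L * m).
Proof. by move=> t0 H1 H2; rewrite -(ler_pM2l t0); lra. Qed.

(** [A], [B], [C] stand for the gradient integrals of [u], [v] and [w = u + t (v - u)], [U] and [V]
    for the integrals of [u] and [v]; the hypotheses are minimality of [u] against [w] and equality
    of the two minimal energies. *)
Lemma convex_energy_le (F : realFieldType) (A B C U V t : F) :
  A - U <= C - (U + t * (V + (-1) * U)) -> B - V = A - U ->
  (1 - t) * A + t * B - C <= 0.
Proof.
move=> H1 E; have -> : B = A - U + V by rewrite -E subrK.
by move: H1; rewrite mulN1r; lra.
Qed.

(** * First variation of the energy and comparison of minimizers *)

Section Variations.
Set Implicit Arguments.
Unset Strict Implicit.
Context {R : realType} {N : nat} (HN : (0 < N)%N)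
  (mu : {measure set (BorelRn R N) -> \bar R}) (Hmu : is_lebesgue mu)
  (Omega : set 'rV[R]_N) (HOmega : bounded_domain Omega)
  (f f' f'' : R -> R) (sigma alpha : R)
  (Hf1 : cond_f1 f f') (Hf2 : cond_f2 f f' f'' sigma alpha) (Hsigma : 0 < sigma).
Implicit Types (u v w phi : 'rV[R]_N -> R) (x : 'rV[R]_N).

Let D : set (BorelRn R N) := Omega.
Let J (g : 'rV[R]_N -> R) : R := \int[mu]_(x in D) (g : BorelRn R N -> R) x.

Let mD : measurable D.
Proof. by case: HOmega => oO _ _ _; exact: measurable_open_Rn. Qed.

Let Dfin : (mu D < +oo)%E.
Proof. by case: HOmega => _ _ _ bO; exact: lebesgue_bounded_fin. Qed.

Let integrable_bounded (g : BorelRn R N -> R) (M : R) :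
  measurable_fun setT g -> (forall x, `|g x| <= M) -> mu.-integrable D (EFin \o g).
Proof.
move=> mg gM; apply: measurable_bounded_integrable => //; first exact: measurable_funTS.
exists M; split; first exact: num_real.
by move=> M' MM' y _ /=; rewrite (le_trans (gM y))// ltW.
Qed.

Let W_bounded u : W1inf0 Omega u -> exists M : R, forall x, `|u x| <= M.
Proof. by case: HOmega => _ _ _ bO; exact: W1inf0_bounded. Qed.

Lemma integrable_W1inf0 u : W1inf0 Omega u ->
  mu.-integrable D (EFin \o (u : BorelRn R N -> R)).
Proof.
move=> Wu; have [M uM] := W_bounded Wu; apply: (@integrable_bounded _ M) => //.
by apply: continuous_measurable_Rn; exact: W1inf0_continuous Wu.
Qed.

Lemma integrable_integrand_grad u : W1inf0 Omega u ->
  mu.-integrable D (EFin \o ((fun x => f (grad_norm u x)) : BorelRn R N -> R)).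
Proof.
move=> Wu; have [[k uk] _] := Wu.
apply: (@integrable_bounded _ (f (N%:R * `|k|))).
  by apply: (measurable_integrand_grad Hf1); exact: W1inf0_continuous Wu.
move=> x; rewrite ger0_norm; last exact: (integrand_ge0 Hf1 (grad_norm_ge0 _ _)).
exact: (integrand_mono Hf1 (grad_norm_ge0 _ _) (lip_grad_norm_le uk x)).
Qed.

Lemma energyE u : W1inf0 Omega u ->
  energy mu Omega f u = (J (fun x => f (grad_norm u x)) - J u)%:E.
Proof.
move=> Wu; have iu := integrable_W1inf0 Wu; have ig := integrable_integrand_grad Wu.
rewrite /energy; under eq_integral do rewrite EFinB.
by rewrite integralB_EFin// EFinB /J /Rintegral !fineK//; exact: integrable_fin_num.
Qed.

Lemma W1inf0_J_lin u v (a : R) : W1inf0 Omega u -> W1inf0 Omega v ->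
  J (fun x => u x + a * v x) = J u + a * J v.
Proof.
move=> Wu Wv; have iu := integrable_W1inf0 Wu; have iv := integrable_W1inf0 Wv.
rewrite /J RintegralD//; first by rewrite RintegralZl.
exact: (integrableZl mD a iv).
Qed.

(** The bound [r] is left free: the first variation takes it small, the comparison of two minimizers
    takes [r = 1]. *)
Lemma ex_null_line u phi (r : R) : W1inf0 Omega u -> W1inf0 Omega phi -> 0 < r ->
  exists2 t, 0 < t < r & exists Z : set (BorelRn R N), [/\ measurable Z, mu Z = 0 &
    forall x, Omega x -> ~ Z x ->
      differentiable ((fun y => u y + t * phi y) : 'rV[R]_N -> R^o) x ->
      differentiable (u : 'rV[R]_N -> R^o) x].
Proof.
move=> Wu Wphi r0.
pose du : set (BorelRn R N) := [set x | differentiable (u : 'rV[R]_N -> R^o) x].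
pose dt t : set (BorelRn R N) :=
  [set x | differentiable ((fun y => u y + t * phi y) : 'rV[R]_N -> R^o) x].
have mB t : measurable (D `&` (dt t `\` du)).
  apply: measurableI => //; apply: measurableD; apply: measurable_differentiable.
    exact: W1inf0_continuous (W1inf0_lin t Wu Wphi).
  exact: W1inf0_continuous Wu.
have BD t : D `&` (dt t `\` du) `<=` D by move=> x [].
have Bdisj s t : s <> t -> (D `&` (dt s `\` du)) `&` (D `&` (dt t `\` du)) = set0.
  move=> st; rewrite -subset0 => x [[_ [dsx ndu]] [_ [dtx _]]]; apply: ndu.
  exact: affine_line_differentiable st dsx dtx.
have [t tr t0] := ex_null_disjoint mD Dfin mB BD Bdisj r0.
exists t => //; exists (D `&` (dt t `\` du)); split=> // x Ox nZ dx.
by apply: contrapT => ndu; exact: nZ.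
Qed.

Lemma minimizer_variation u phi (Z : set (BorelRn R N)) :
  is_minimizer mu Omega f u -> W1inf0 Omega phi -> measurable Z -> mu Z = 0 ->
  (forall x, Omega x -> ~ Z x -> sigma < grad_norm u x -> has_grad phi x 0) ->
  J phi <= 0.
Proof.
move=> [Wu umin] Wphi mZ muZ gphi.
have [[k phik] _] := Wphi; pose L := N%:R * `|k|.
have L0 : 0 <= L by rewrite mulr_ge0.
have phiL x : grad_norm phi x <= L by exact: lip_grad_norm_le.
pose m := fine (mu D); have m0 : 0 <= m by exact: fine_ge0.
(* [L * m] is fixed while [eps] is arbitrary; the bound comes from minimality against [u + t phi],
   divided by [t]. *)
suff key eps : 0 < eps -> J phi <= eps * (L * m).
  apply/ler_addgt0Pr => e e0; rewrite add0r.
  have Lm : 0 < L * m + 1 by rewrite ltr_wpDl// mulr_ge0.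
  rewrite (le_trans (key _ (divr_gt0 e0 Lm)))// mulrAC ler_pdivrMr//.
  by rewrite ler_wpM2l ?lerDl// ltW.
move=> eps0; have [d d0 fd] := integrand_little_o Hf1 Hf2 Hsigma eps0.
(* Taking [t] below [d / (L + 1)] ensures [t * L <= d], also when [L = 0]. *)
have [t /andP[t0 td] [Y [mY muY dY]]] := ex_null_line Wu Wphi (divr_gt0 d0 (ltr_wpDl L0 ltr01)).
have tL : t * L <= d.
  move: td; rewrite ltr_pdivlMr ?ltr_wpDl// mulrDr mulr1 => /ltW; apply: le_trans.
  by rewrite lerDl ltW.
have fw x : Omega x -> ~ (Z `|` Y) x ->
    f (grad_norm (fun y => u y + t * phi y) x) <= f (grad_norm u x) + eps * (t * L).
  move=> Ox nZY; apply: (integrand_variation (u := u) Hf1 t0 (phiL x) tL (ltW eps0) fd).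
    by apply: dY => // Yx; apply: nZY; right.
  by apply: gphi => // Zx; apply: nZY; left.
have [w wE] : exists w, w = (fun y => u y + t * phi y) by eexists.
have Ww : W1inf0 Omega w by rewrite wE; exact: W1inf0_lin.
rewrite -wE in fw.
have iu := integrable_integrand_grad Wu; have iw := integrable_integrand_grad Ww.
have mZY : measurable (Z `|` Y) by exact: measurableU.
have muZY : mu (Z `|` Y) = 0 by rewrite measureU0.
have JE : J (fun x => f (grad_norm w x)) <= J (fun x => f (grad_norm u x)) + eps * (t * L) * m.
  exact: (le_Rintegral_off_null_addr mD mZY muZY Dfin iw iu fw).
have := umin _ Ww; rewrite !energyE// lee_fin [X in _ <= _ - J X]wE W1inf0_J_lin// => H.
exact: (variation_energy_le t0 JE H).
Qed.

(** The convexity defect [h] of the integrand at [w = (1 - t) u + t v] is nonnegative off a null set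
    and its integral is at most 0; so it vanishes almost everywhere, and the equality case
    applies. *)
Lemma minimizers_grad_eq u v : is_minimizer mu Omega f u -> is_minimizer mu Omega f v ->
  exists Z : set (BorelRn R N), [/\ measurable Z, mu Z = 0 &
    forall x, Omega x -> ~ Z x -> sigma < grad_norm u x ->
      has_grad (fun y => u y - v y) x 0].
Proof.
move=> [Wu umin] [Wv vmin].
pose phi x := v x + (-1) * u x; have Wphi : W1inf0 Omega phi by exact: W1inf0_lin.
have [t t01 [Z [mZ muZ dZ]]] := ex_null_line Wu Wphi ltr01.
have [t0 t1] : 0 < t /\ 0 < 1 - t by case/andP: t01; rewrite subr_gt0.
have [w wE] : exists w, w = (fun y => u y + t * phi y) by eexists.
have Ww : W1inf0 Omega w by rewrite wE; exact: W1inf0_lin.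
rewrite -wE in dZ.
have grads x : Omega x -> ~ Z x -> differentiable (w : 'rV[R]_N -> R^o) x ->
    exists p q, [/\ has_grad u x p, has_grad v x q &
      has_grad w x ((1 - t) *: p + t *: q)].
  move=> Ox nZ dw; have [p up] := differentiable_has_grad (dZ x Ox nZ dw).
  have [r wr] := differentiable_has_grad dw.
  (* The choice of [t] has secured the gradient of [u]; that of [v] comes from
     [v = w / t + (1 - 1 / t) u]. *)
  have vq := has_grad_lin t^-1 (1 - t^-1) wr up.
  rewrite (_ : (fun y => _) = v) in vq; last first.
    by apply/funext => y; rewrite wE /phi line_endpoint// gt_eqF.
  exists p, (t^-1 *: r + (1 - t^-1) *: p); split=> //.
  have := has_grad_lin (1 - t) t up vq; rewrite (_ : (fun y => _) = w)//.
  by apply/funext => y; rewrite wE /phi; ring.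
pose h x := (1 - t) * f (grad_norm u x) + t * f (grad_norm v x) - f (grad_norm w x).
have iu := integrable_integrand_grad Wu; have iv := integrable_integrand_grad Wv.
have iw := integrable_integrand_grad Ww.
have ih := integrable_comb3 mD (1 - t) t iu iv iw.
have Jh : J h = (1 - t) * J (fun x => f (grad_norm u x))
    + t * J (fun x => f (grad_norm v x)) - J (fun x => f (grad_norm w x)).
  exact: (Rintegral_comb3 mD (1 - t) t iu iv iw).
have h0 x : D x -> ~ Z x -> 0 <= h x.
  by move=> Ox nZ; rewrite /h subr_ge0; exact: (integrand_grad_convex Hf1 t01 (grads x Ox nZ)).
have Jh0 : J h <= 0.
  (* Testing each minimizer against the other equates their energies; testing [u] against [w] then
     bounds the defect. *)
  have := umin _ Wv; have := vmin _ Wu; have := umin _ Ww.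
  rewrite !energyE// !lee_fin [X in _ <= _ - J X]wE.
  rewrite (W1inf0_J_lin t Wu Wphi) (W1inf0_J_lin (-1) Wv Wu) Jh.
  by move=> uw vu uv; apply: (convex_energy_le uw); apply: le_anti; rewrite vu uv.
have [Y [mY muY hY]] := Rintegral_le0_off_null mD mZ muZ ih h0 Jh0.
exists (Z `|` Y); split; [exact: measurableU|by rewrite measureU0|].
move=> x Ox nZY su.
have nZ : ~ Z x by move=> Zx; apply: nZY; left.
have nY : ~ Y x by move=> Yx; apply: nZY; right.
have /eqP := hY x Ox nY; rewrite /h subr_eq0 => /eqP/esym hx.
exact: (integrand_grad_convex_eq Hf1 Hf2 Hsigma t01 (grads x Ox nZ) su hx).
Qed.

Lemma W1inf0_J_le0_eq0 phi : W1inf0 Omega phi -> (forall x, 0 <= phi x) -> J phi <= 0 ->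
  forall x, phi x = 0.
Proof.
move=> Wphi phi0 Jphi x; have [Ox|nOx] := pselect (Omega x); last by case: Wphi => _; exact.
have [oO _ _ _] := HOmega.
apply: (integral_le0_continuous Hmu oO (W1inf0_continuous Wphi) phi0) => //.
rewrite -[leLHS]fineK ?lee_fin//.
exact: (integrable_fin_num mD (integrable_W1inf0 Wphi)).
Qed.

Lemma minimizer_steep_gt0 u : is_minimizer mu Omega f u ->
  (0 < mu [set x : BorelRn R N | Omega x /\ (sigma < grad_norm u x)%R])%E.
Proof.
move=> umin; have [Wu _] := umin; have [oO _ [x0 Ox0] _] := HOmega.
set S := [set x | _].
have mS : measurable S.
  apply: (@measurableI _ _ D [set x : BorelRn R N | sigma < grad_norm u x]) => //.
  have := measurable_grad_norm (W1inf0_continuous Wu).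
  move=> /(_ measurableT `]sigma, +oo[%classic (measurable_itv _)).
  by rewrite setTI (_ : _ @^-1` _ = [set x | sigma < grad_norm u x])//;
    apply/seteqP; split=> x /=; rewrite in_itv/= andbT.
rewrite lt_neqAle measure_ge0 andbT; apply/eqP => /esym muS.
have [r /= r0 rO] := (@nbhs_normP R 'rV[R]_N x0 _).1 (open_nbhs_nbhs (conj oO Ox0)).
have Wc := W1inf0_cone rO.
(* The steep set, supposed null, serves as the exceptional set, so the gradient condition on the
   cone is vacuous off it. *)
have := minimizer_variation umin Wc mS muS (fun x Ox nS su => False_ind _ (nS (conj Ox su))).
have c0 x : 0 <= Num.max 0 (r - `|x0 - x|) by rewrite le_max lexx.
move=> /(W1inf0_J_le0_eq0 Wc c0)/(_ x0); rewrite subrr normr0 subr0 max_r ?ltW// => E.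
by move: r0; rewrite E ltxx.
Qed.

(** A sign on the integral of [u - v] alone would not make it vanish; its square is nonnegative and
    has gradient 0 wherever [u - v] does. *)
Lemma minimizer_unique u v : is_minimizer mu Omega f u -> is_minimizer mu Omega f v ->
  v = u.
Proof.
move=> umin vmin; have [Z [mZ muZ gZ]] := minimizers_grad_eq umin vmin.
pose w x := u x + (-1) * v x.
have Ww : W1inf0 Omega w by apply: W1inf0_lin; [exact: umin.1|exact: vmin.1].
have [M wM] := W_bounded Ww.
have wE : w = (fun y => u y - v y) by apply/funext => y; rewrite /w mulN1r.
have W2 := W1inf0_sqr (ex_intro _ M wM) Ww.
have := minimizer_variation umin W2 mZ muZ (fun x Ox nZ su =>
  has_grad_sqr0 (eq_ind_r (fun g => has_grad g x 0) (gZ x Ox nZ su) wE) (ex_intro _ M wM)).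
move=> /(W1inf0_J_le0_eq0 W2 (fun x => sqr_ge0 _)) H; apply/funext => x.
by have := H x; rewrite wE => /eqP; rewrite sqrf_eq0 subr_eq0 => /eqP.
Qed.

End Variations.

Theorem theorem2p3 (R : realType) (N : nat) (HN : (0 < N)%N)
    (mu : {measure set (BorelRn R N) -> \bar R}) (Hmu : is_lebesgue mu)
    (Omega : set 'rV[R]_N) (HOmega : bounded_domain Omega)
    (f f' f'' : R -> R) (sigma alpha : R)
    (Hf1 : cond_f1 f f') (Hf2 : cond_f2 f f' f'' sigma alpha)
    (Hsigma : 0 < sigma)
    (u : 'rV[R]_N -> R) (Hu : is_minimizer mu Omega f u) :
  (0 < mu [set x : BorelRn R N | Omega x /\ (sigma < grad_norm u x)%R])%E /\
  (forall v : 'rV[R]_N -> R, is_minimizer mu Omega f v -> v = u).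
Proof.
split; first exact: (minimizer_steep_gt0 HN Hmu HOmega Hf1 Hf2 Hsigma Hu).
by move=> v Hv; exact: (minimizer_unique HN Hmu HOmega Hf1 Hf2 Hsigma Hu Hv).
Qed.
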